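(* $\Theta_{2,2}=2$.
   Context: A rank $b$ normed lattice is a triple $(V,\Lambda,K)$ with $V$ a $b$-dimensional real vector space, $\Lambda\subset V$ a (full rank) lattice, and $K\subset V$ a convex body (compact, convex, nonempty interior) symmetric about the origin; $\|\cdot\|_K$ is the norm on $V$ with unit ball $K$. Let $\lambda_1(K,\Lambda)=\min\{\|a\|_K:0\neq a\in\Lambda\}$. Let $\Lambda^*\subset V^*$ be the dual lattice and $K^\circ=\{\alpha\in V^*:|\alpha(v)|\le 1\ \forall v\in K\}$ the polar body. For $n\ge 2$ let $\mu_n(K,\Lambda)=\max_{\rho\in\Lambda/n\Lambda}\ \min\{\|\lambda\|_K:\lambda\in\Lambda,\ \lambda\equiv\rho \pmod n\}$, and similarly for $(K^\circ,\Lambda^* )$. For $b>0$ and $n\ge 2$ define $$\Theta_{b,n}=\sup_{(V,\Lambda,K)}\lambda_1(K,\Lambda)\,\mu_n(K^\circ,\Lambda^* ),$$ the supremum being over all rank $b$ normed lattices. *)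

(* Defs.v *)
From HB Require Import structures.
From mathcomp Require Import all_boot all_order all_algebra.
From mathcomp Require Import all_classical all_reals all_analysis.

Set Implicit Arguments.
Unset Strict Implicit.
Unset Printing Implicit Defensive.

Import Order.TTheory GRing.Theory Num.Theory numFieldNormedType.Exports.

Local Open Scope classical_set_scope.
Local Open Scope ring_scope.

Section NormedLattice.
Context {R : realType}.

(* A vectType carries no topology of its own: topological notions on V are
   read through the coordinates in a basis, and do not depend on its choice. *)
Definition coords (V : vectType R) (v : V) : 'rV[R]_(\dim {:V}) :=
  \row_i coord (vbasis {:V}) i v.

Definition is_full_lattice (V : vectType R) (L : set V) : Prop :=
  exists2 e : seq V, basis_of {:V} e &
    L = [set v : V | exists z : 'I_(size e) -> int,
      v = \sum_(i < size e) e`_i *~ z i].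

Definition is_symmetric_convex_body (V : vectType R) (K : set V) : Prop :=
  [/\ compact (@coords V @` K), convex_set K, (@coords V @` K)° !=set0 &
      forall v, K v -> K (- v)].

Definition normed_lattice (b : nat) (V : vectType R) (L K : set V) : Prop :=
  [/\ \dim {:V} = b, is_full_lattice L & is_symmetric_convex_body K].

Definition body_norm (V : vectType R) (K : set V) (v : V) : R :=
  inf [set r : R | 0 <= r /\ exists2 k, K k & v = r *: k].

Definition dual (V : vectType R) : vectType R := 'Hom(V, R^o).

Definition dual_lattice (V : vectType R) (L : set V) : set (dual V) :=
  [set a : 'Hom(V, R^o) | forall v, L v -> (a v : R) \is a Num.int].

Definition polar (V : vectType R) (K : set V) : set (dual V) :=
  [set a : 'Hom(V, R^o) | forall v, K v -> `|a v : R| <= 1].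

(* The infimum is a minimum: L is discrete and K is bounded. *)
Definition lambda1 (V : vectType R) (K L : set V) : R :=
  inf [set body_norm K a | a in L `\ 0].

Definition congr_lattice (V : vectType R) (L : set V) (n : nat) (x y : V) :
    Prop :=
  exists2 d : V, L d & x - y = d *+ n.

(* The classes of L / nL are given by representatives p in L. Each infimum is
   a minimum, and the supremum a maximum because L / nL is finite. *)
Definition mu (n : nat) (V : vectType R) (K L : set V) : R :=
  sup [set inf [set body_norm K l | l in [set l | L l /\ congr_lattice L n l p]]
      | p in L].

End NormedLattice.

Definition Theta (R : realType) (b n : nat) : \bar R :=
  ereal_sup [set x : \bar R | exists (V : vectType R) (L K : set V),
    normed_lattice b L K /\
    x = (lambda1 K L * mu n (polar K) (dual_lattice L))%:E].

(* Main.v *)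
Require Import Defs.
From mathcomp Require Import all_boot all_order all_algebra.
From mathcomp Require Import all_classical all_reals all_analysis.
From mathcomp Require Import ring lra zify.

Set Implicit Arguments.
Unset Strict Implicit.
Unset Printing Implicit Defensive.

Import Order.TTheory GRing.Theory Num.Theory numFieldNormedType.Exports.

Local Open Scope classical_set_scope.
Local Open Scope ring_scope.

(** The upper bound rests on a basis reduced with respect to the norm N of K.
Among all bases of the lattice L take u, v with N u + N v (almost) minimal: then
u + v and u - v are no shorter than u and v. Write l for lambda1 and f, g for
the basis dual to u, v. The nonzero classes of L* mod 2 are those of f, g and
f + g, and f - g lies in the class of f + g; so it is enough that f, g and one
of f + g, f - g take values of absolute value at most 2 / l on K, that is, have
polar norm at most 2 / l.

- For f and g this says that N (a u + b v) is at least l max(|a|, |b|) / 2, a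
  consequence of reducedness and of two triangle inequalities
  ([seminorm_coord_bound]).
- For f + g it would suffice that N (a u + b v) is at least l (|a| + |b|) / 2
  when a and b have the same sign, for f - g when they have opposite signs. If
  both failed, at x and at y, the symmetric hull of two multiples of x and y
  would meet one of the axes at a point that forces N u < l or N v < l
  ([seminorm_quadrant_alternative]).

An almost reduced basis gives these bounds with any l below lambda1 in place of
lambda1 ([class_norm_bound]), which is enough for the supremum. If lambda1 = 0
the product is 0.

The value 2 is reached by the square K = [-1, 1]^2 and L = Z^2: lambda1 is 1,
the polar norm is the l1 norm, and the elements of the class of (1, 1) have two
odd coordinates, hence l1 norm at least 2. *)

(** * Seminorm inequalities in a plane *)

Section Seminorm.
Context {R : realType} {V : lmodType R}.
Implicit Types (N : V -> R) (x y u v : V).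

Definition is_seminorm N :=
  (forall x y, N (x + y) <= N x + N y) /\
  (forall a x, N (a *: x) = `|a| * N x).

Lemma seminormN N x : is_seminorm N -> N (- x) = N x.
Proof. by case=> _ NZ; rewrite -scaleN1r NZ normrN normr1 mul1r. Qed.

Lemma seminorm_ge0 N x : is_seminorm N -> 0 <= N x.
Proof.
move=> N_ok; have [ND NZ] := N_ok.
have := ND x (- x); rewrite seminormN// subrr -[X in N X](scale0r x) NZ.
rewrite normr0 mul0r; lra.
Qed.

(** The larger coordinate, say a, is bounded by writing both a (u + v) and a u in
terms of w = a u + b v and a multiple of v, and adding the two triangle
inequalities; what is left of v is a N v, to be compared with a N u. *)
Lemma seminorm_quadrant_bound N u v l a b : is_seminorm N -> 0 <= l ->
  `|N u - N v| + l <= N (u + v) -> 0 <= a -> 0 <= b ->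
  a * l <= 2 * N (a *: u + b *: v).
Proof.
move=> N_ok l0.
have ordered u' v' a' b' : `|N u' - N v'| + l <= N (u' + v') -> 0 <= b' ->
    b' <= a' -> a' * l <= 2 * N (a' *: u' + b' *: v').
  move=> uv b0 ba; have [ND NZ] := N_ok.
  set w := a' *: u' + b' *: v'.
  have hsum : a' * N (u' + v') <= N w + (a' - b') * N v'.
    rewrite -[X in X * N (_ + _)]ger0_norm; last lra.
    rewrite -NZ -[X in _ + X * _]ger0_norm; last lra.
    rewrite -NZ; apply: le_trans (ND _ _).
    rewrite /w -addrA -scalerDl [b' + _]addrC subrK scalerDr.
    exact: lexx.
  have hu : a' * N u' <= N w + b' * N v'.
    rewrite -[X in X * N u']ger0_norm; last lra.
    rewrite -NZ -[X in _ + X * _]ger0_norm// -NZ -(seminormN (b' *: v'))//.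
    by apply: le_trans (ND _ _); rewrite /w addrK.
  have : N v' - N u' + l <= N (u' + v').
    by apply: le_trans uv; rewrite lerD2r -opprB ler_normr lexx orbT.
  have a0 : 0 <= a' by lra.
  move=> /(ler_wpM2l a0); nra.
move=> uv a0 b0; have [ba|ab] := leP b a; first exact: ordered.
apply: (@le_trans _ _ (b * l)); first by rewrite ler_wpM2r// ltW.
rewrite [a *: u + _]addrC; apply: ordered => //; last exact: ltW.
by rewrite distrC [v + u]addrC.
Qed.

(** The hypotheses are what an exactly reduced basis with N u, N v >= l
satisfies; in this form they survive an error in the reduction. *)
Lemma seminorm_coord_bound N u v l a b : is_seminorm N -> 0 <= l ->
  `|N u - N v| + l <= N (u + v) -> `|N u - N v| + l <= N (u - v) ->
  `|a| * l <= 2 * N (a *: u + b *: v).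
Proof.
move=> N_ok l0 uv uNv.
have nonneg a' b' : 0 <= a' -> a' * l <= 2 * N (a' *: u + b' *: v).
  move=> a0; have [b0|/ltW b0] := leP 0 b'.
    exact: seminorm_quadrant_bound.
  rewrite -[b']opprK scaleNr -scalerN seminorm_quadrant_bound ?seminormN//.
  by rewrite oppr_ge0.
have [a0|/ltW a0] := leP 0 a; first by rewrite ger0_norm// nonneg.
rewrite ler0_norm// -(seminormN (a *: u + _) N_ok) opprD -!scaleNr nonneg//.
by rewrite oppr_ge0.
Qed.

(** Suppose x = a u + b v and y = c u - d v violate the two bounds. Combining
them to kill the v or the u component gives a d + b c < 2 b d and
a d + b c < 2 a c; the product of these contradicts the inequality of the
arithmetic and geometric means for a d and b c. *)
Lemma seminorm_quadrant_alternative N u v l a b c d : is_seminorm N -> 0 < l ->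
  l <= N u -> l <= N v -> 0 <= a -> 0 <= b -> 0 <= c -> 0 <= d ->
  (a + b) * l <= 2 * N (a *: u + b *: v) \/
  (c + d) * l <= 2 * N (c *: u - d *: v).
Proof.
move=> N_ok l0 lu lv a0 b0 c0 d0; have [ND NZ] := N_ok.
set x := a *: u + b *: v; set y := c *: u - d *: v.
have [?|hx] := leP ((a + b) * l) (2 * N x); first by left.
have [?|hy] := leP ((c + d) * l) (2 * N y); first by right.
have Nx := seminorm_ge0 x N_ok; have Ny := seminorm_ge0 y N_ok.
have NZge k z : 0 <= k -> N (k *: z) = k * N z.
  by move=> k0; rewrite NZ ger0_norm.
have NB z w : N (z - w) <= N z + N w.
  by rewrite -(seminormN w)//.
have hu : (a * d + b * c) * N u <= d * N x + b * N y.
  rewrite -NZge; last by nra.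
  rewrite -!NZge//; apply: le_trans (ND _ _).
  rewrite /x /y !(scalerDr, scalerN, scalerA) (mulrC d b) addrACA subrr addr0.
  by rewrite scalerDl (mulrC a).
have hv : (a * d + b * c) * N v <= c * N x + a * N y.
  rewrite -NZge; last by nra.
  rewrite -!NZge//; apply: le_trans (NB _ _).
  rewrite /x /y !(scalerDr, scalerN, scalerA) opprD opprK (mulrC c a).
  by rewrite addrACA subrr add0r -scalerDl addrC (mulrC c).
(* On the axes N is at least l times the l1 norm, so that x and y are off them
   and the two inequalities below are strict. *)
have apos : 0 < a.
  rewrite lt_neqAle a0 andbT eq_sym; apply/eqP => az.
  move: hx; rewrite /x az scale0r !add0r NZge//; nra.
have bpos : 0 < b.
  rewrite lt_neqAle b0 andbT eq_sym; apply/eqP => bz.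
  move: hx; rewrite /x bz scale0r !addr0 NZge//; nra.
have cpos : 0 < c.
  rewrite lt_neqAle c0 andbT eq_sym; apply/eqP => cz.
  move: hy; rewrite /y cz scale0r !add0r seminormN// NZge//; nra.
have dpos : 0 < d.
  rewrite lt_neqAle d0 andbT eq_sym; apply/eqP => dz.
  move: hy; rewrite /y dz scale0r subr0 !addr0 NZge//; nra.
have h1 : a * d + b * c < 2 * (b * d).
  rewrite -(ltr_pM2r l0).
  have : (a * d + b * c) * l <= (a * d + b * c) * N u.
    by rewrite ler_wpM2l//; nra.
  have : d * (2 * N x) < d * ((a + b) * l) by rewrite ltr_pM2l.
  have : b * (2 * N y) < b * ((c + d) * l) by rewrite ltr_pM2l.
  nra.
have h2 : a * d + b * c < 2 * (a * c).
  rewrite -(ltr_pM2r l0).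
  have : (a * d + b * c) * l <= (a * d + b * c) * N v.
    by rewrite ler_wpM2l//; nra.
  have : c * (2 * N x) < c * ((a + b) * l) by rewrite ltr_pM2l.
  have : a * (2 * N y) < a * ((c + d) * l) by rewrite ltr_pM2l.
  nra.
have : (a * d + b * c) * (a * d + b * c) < (2 * (b * d)) * (2 * (a * c)).
  by rewrite ltr_pM//; nra.
have := sqr_ge0 (a * d - b * c); rewrite expr2; nra.
Qed.

End Seminorm.

(** * The norm of a convex body *)

Section BodyNorm.
Context {R : realType} {V : vectType R}.
Implicit Types (K : set V) (x y k : V) (r : R).

Lemma body_norm_ge0 K x : 0 <= body_norm K x.
Proof.
rewrite /body_norm; set S := [set _ | _].
have [->|/set0P S0] := eqVneq S set0; first by rewrite inf0.
by apply: lb_le_inf => // r [].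
Qed.

Lemma body_norm_le K r k : 0 <= r -> K k -> body_norm K (r *: k) <= r.
Proof.
by move=> r0 Kk; apply: ge_inf; [exists 0 => s [] | split => //; exists k].
Qed.

(** Where it fails, [body_norm K x] is the infimum of the empty set, that is 0
by convention rather than infinity. *)
Definition absorbs K x := exists r k, [/\ 0 <= r, K k & x = r *: k].

Lemma le_body_norm K x r : absorbs K x ->
  (forall s k, 0 <= s -> K k -> x = s *: k -> r <= s) -> r <= body_norm K x.
Proof.
move=> [s [k [s0 Kk xE]]] hr; apply: lb_le_inf.
  by exists s; split=> //; exists k.
by move=> t [t0 [k' Kk' xE']]; exact: hr xE'.
Qed.

Lemma body_norm_gt0_absorbs K x : 0 < body_norm K x -> absorbs K x.
Proof.
rewrite /body_norm; set S := [set _ | _].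
have [->|/set0P[r [r0 [k Kk ->]]] _] := eqVneq S set0.
  by rewrite inf0 ltxx.
by exists r, k.
Qed.

Lemma convex_set_segment K x y t : convex_set K -> 0 <= t -> t <= 1 ->
  K x -> K y -> K (t *: x + (1 - t) *: y).
Proof.
by move=> cK t0 t1 Kx Ky; have := cK x y (Itv01 t0 t1); rewrite !inE; apply.
Qed.

Lemma convex_set_add K r s x y : convex_set K -> 0 <= r -> 0 <= s ->
  K x -> K y -> exists2 z, K z & r *: x + s *: y = (r + s) *: z.
Proof.
move=> cK r0 s0 Kx Ky; have [rs0|rs0] := eqVneq (r + s) 0.
  have [-> ->] : r = 0 /\ s = 0 by split; lra.
  by exists x => //; rewrite addr0 !scale0r addr0.
exists (r / (r + s) *: x + (1 - r / (r + s)) *: y).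
  apply: convex_set_segment => //; first by rewrite divr_ge0//; lra.
  by rewrite ler_pdivrMr; lra.
by rewrite scalerDr !scalerA; congr (_ *: _ + _ *: _); field.
Qed.

Lemma symmetric_scale K a r x : (forall y, K y -> K (- y)) ->
  K x -> exists2 z, K z & a *: (r *: x) = (`|a| * r) *: z.
Proof.
move=> NK Kx; have [a0|a0] := leP 0 a.
  by exists x; rewrite ?ger0_norm ?scalerA.
exists (- x); first exact: NK.
by rewrite ltr0_norm// scalerN -scaleNr -mulNr opprK scalerA.
Qed.

Lemma absorbsD K x y : convex_set K ->
  absorbs K x -> absorbs K y -> absorbs K (x + y).
Proof.
move=> cK [r [k [r0 Kk ->]]] [s [k' [s0 Kk' ->]]].
have [z Kz ->] := convex_set_add cK r0 s0 Kk Kk'.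
by exists (r + s), z; rewrite addr_ge0.
Qed.

Lemma absorbsZ K a x : (forall y, K y -> K (- y)) ->
  absorbs K x -> absorbs K (a *: x).
Proof.
move=> NK [r [k [r0 Kk ->]]]; have [z Kz ->] := symmetric_scale a r NK Kk.
by exists (`|a| * r), z; rewrite mulr_ge0.
Qed.

Lemma body_norm_seminorm K : convex_set K -> (forall x, K x -> K (- x)) ->
  (forall x, absorbs K x) -> is_seminorm (body_norm K).
Proof.
move=> cK NK aK; split=> [x y|a x].
  rewrite -lerBlDr; apply: le_body_norm => // r k r0 Kk ->.
  rewrite lerBlDr -lerBlDl; apply: le_body_norm => // s k' s0 Kk' ->.
  rewrite lerBlDl; have [z Kz ->] := convex_set_add cK r0 s0 Kk Kk'.
  by rewrite body_norm_le// addr_ge0.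
have le_scale b z : body_norm K (b *: z) <= `|b| * body_norm K z.
  have [->|b0] := eqVneq b 0.
    have [r [k [_ Kk _]]] := aK 0.
    rewrite scale0r normr0 mul0r -[X in body_norm _ X](scale0r k).
    exact: body_norm_le.
  rewrite -ler_pdivrMl ?normr_gt0//; apply: le_body_norm => // r k r0 Kk ->.
  rewrite ler_pdivrMl ?normr_gt0//.
  have [w Kw ->] := symmetric_scale b r NK Kk.
  by rewrite body_norm_le// mulr_ge0.
apply/eqP; rewrite eq_le le_scale /=.
have [->|a0] := eqVneq a 0; first by rewrite normr0 mul0r body_norm_ge0.
rewrite -ler_pdivlMl ?normr_gt0// -normfV.
by rewrite -{1}[x](scalerK a0) le_scale.
Qed.

End BodyNorm.

Section Polar.
Context {R : realType} {V : vectType R}.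
Implicit Types (K : set V).

Lemma polar_scale K (q : 'Hom(V, R^o)) c : 0 < c ->
  (forall k, K k -> `|q k : R| <= c) -> polar K (c^-1 *: q).
Proof.
move=> c0 qc k Kk /=; rewrite scale_lfunE.
by rewrite normrM normfV (gtr0_norm c0) ler_pdivrMl// mulr1 qc.
Qed.

Lemma body_norm_polar_le K (q : 'Hom(V, R^o)) c : 0 < c ->
  (forall k, K k -> `|q k : R| <= c) -> body_norm (polar K) (q : dual V) <= c.
Proof.
move=> c0 qc; rewrite -[X in body_norm _ X](scalerKV (lt0r_neq0 c0)).
by apply: (@body_norm_le R (dual V)); [exact: ltW | exact: polar_scale].
Qed.

End Polar.

(** * Lattice bases and classes modulo 2 *)

Definition subgroup (V : zmodType) (L : set V) :=
  [/\ L 0, forall u v, L u -> L v -> L (u + v) & forall u, L u -> L (- u)].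

Section DualBases.
Context {R : realType} {V : vectType R}.
Implicit Types (L : set V) (u v x : V) (f g p : 'Hom(V, R^o)).

(** The dual basis f, g is carried along with the basis u, v: f and g give the
coordinates, and membership in the dual lattice says that u, v span L over the
integers. *)
Definition dual_bases L u v f g :=
  [/\ L u, L v, dual_lattice L f & dual_lattice L g] /\
  [/\ f u = 1, f v = 0, g u = 0, g v = 1 &
      forall x, x = (f x : R) *: u + (g x : R) *: v].

Lemma lattice_subgroup L : is_full_lattice L -> subgroup L.
Proof.
move=> [e _ ->]; split.
- by exists (fun=> 0); rewrite big1.
- move=> _ _ [z ->] [t ->]; exists (fun i => z i + t i).
  by rewrite -big_split; apply: eq_bigr => i _; rewrite mulrzDr.
- move=> _ [z ->]; exists (fun i => - z i).
  by rewrite -sumrN; apply: eq_bigr => i _; rewrite mulrNz.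
Qed.

Lemma dual_lattice_subgroup L : subgroup (dual_lattice L : set (dual V)).
Proof.
split=> [v _|f g Lf Lg v Lv|f Lf v Lv] /=.
- by rewrite zero_lfunE.
- by rewrite add_lfunE rpredD ?Lf ?Lg.
- by rewrite opp_lfunE rpredN Lf.
Qed.

Lemma dual_bases_swap L u v f g : dual_bases L u v f g -> dual_bases L v u g f.
Proof.
by move=> [[? ? ? ?] [? ? ? ? xE]]; split; split=> // x; rewrite addrC.
Qed.

Lemma dual_bases_opp L u v f g : subgroup L ->
  dual_bases L u v f g -> dual_bases L u (- v) f (- g).
Proof.
move=> [_ _ LN] [[Lu Lv Lf Lg] [fu fv gu gv xE]].
have [_ _ dN] := dual_lattice_subgroup L.
split; split=> //.
- exact: LN.
- exact: dN.
- by rewrite linearN/= fv oppr0.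
- by rewrite opp_lfunE gu oppr0.
- by rewrite opp_lfunE linearN/= gv opprK.
- by move=> x; rewrite opp_lfunE scaleNr scalerN opprK.
Qed.

Lemma dual_bases_shear L u v f g : subgroup L ->
  dual_bases L u v f g -> dual_bases L u (u + v) (f - g) g.
Proof.
move=> [_ LD _] [[Lu Lv Lf Lg] [fu fv gu gv xE]].
have [_ dD dN] := dual_lattice_subgroup L.
split; split=> //.
- exact: LD.
- by apply: dD => //; exact: dN.
- by rewrite add_lfunE opp_lfunE fu gu subr0.
- rewrite add_lfunE opp_lfunE (linearD f) (linearD g)/= fu fv gu gv.
  by rewrite addr0 add0r subrr.
- by rewrite linearD/= gu gv add0r.
- move=> x; rewrite add_lfunE opp_lfunE/= scalerDr addrA -scalerDl subrK.
  exact: xE.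
Qed.

Lemma lattice_dual_bases L : \dim {:V} = 2%N -> is_full_lattice L ->
  exists u v f g, dual_bases L u v f g.
Proof.
move=> dimV [e e_basis ->].
have : size e = 2%N by rewrite -dimV (size_basis (X := in_tuple e) e_basis).
case: e e_basis => [|u [|v [|]]]// e_basis _.
pose X := [tuple u; v].
have X_basis : basis_of {:V} X by [].
have X_free := basis_free X_basis.
exists u, v, (linfun (coord X 0 : V -> R^o)), (linfun (coord X 1 : V -> R^o)).
have c_free i j := coord_free i j X_free.
have coord_int j w :
    (exists z : 'I_2 -> int, w = \sum_(i < 2) [:: u; v]`_i *~ z i) ->
    coord X j w \is a Num.int.
  move=> [z ->]; rewrite linear_sum /= rpred_sum// => i _.
  by rewrite raddfMz rpredMz//=; have /= -> := c_free i j; rewrite natr_int.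
split; split.
- exists (fun i => (i == 0 :> nat)); rewrite big_ord_recl big_ord1.
  by rewrite /= mulr1z mulr0z addr0.
- exists (fun i => (i == 1 :> nat)); rewrite big_ord_recl big_ord1.
  by rewrite /= mulr1z mulr0z add0r.
- by move=> w Lw; rewrite lfunE coord_int.
- by move=> w Lw; rewrite lfunE coord_int.
- by rewrite lfunE /= (c_free 0 0).
- by rewrite lfunE /= (c_free 1 0).
- by rewrite lfunE /= (c_free 0 1).
- by rewrite lfunE /= (c_free 1 1).
move=> x; rewrite !lfunE /= {1}(coord_basis X_basis (memvf x)).
rewrite big_ord_recl big_ord1; congr (_ *: _ + coord X _ x *: _).
exact: val_inj.
Qed.

Lemma int_parity (m : R) : m \is a Num.int ->
  exists2 k : R, k \is a Num.int & m = 2 * k \/ m = 1 + 2 * k.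
Proof.
move=> /intrP[z ->]; exists (z %/ 2)%Z%:~R; first exact: intr_int.
have := divz_eq z 2; have := modz_ge0 z (isT : 2 != 0 :> int).
have := ltz_pmod z (isT : 0 < 2 :> int).
move: (z %% 2)%Z (z %/ 2)%Z => r q.
case: r => [[|[|//]]|//] _ _ ->; [left|right];
 rewrite !rmorphD !rmorphM /=; ring.
Qed.

(** The values of p at u and v are its coordinates in the basis f, g of the dual
lattice, and their parities determine its class. *)
Lemma class_representative L u v f g (K : set V) c p :
  dual_bases L u v f g -> 0 <= c ->
  (forall k, K k -> `|f k : R| <= c) -> (forall k, K k -> `|g k : R| <= c) ->
  (forall k, K k -> `|(f + g) k : R| <= c) -> dual_lattice L p ->
  exists q, [/\ dual_lattice L q, congr_lattice (dual_lattice L) 2 q p &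
    forall k, K k -> `|q k : R| <= c].
Proof.
move=> [[Lu Lv Lf Lg] [fu fv gu gv xE]] c0 fc gc fgc Lp.
have [d0 dD dN] := dual_lattice_subgroup L.
have [k k_int pu] := int_parity (Lp _ Lu).
have [l l_int pv] := int_parity (Lp _ Lv).
have dZ (a : R) (h : 'Hom(V, R^o)) : a \is a Num.int -> dual_lattice L h ->
    dual_lattice L (a *: h).
  by move=> a_int Lh w Lw; rewrite scale_lfunE rpredM ?Lh.
have pE : p = (p u : R) *: f + (p v : R) *: g.
  apply/lfunP => x; rewrite {1}(xE x) linearD !linearZ/= add_lfunE !scale_lfunE /=.
  by rewrite ![_ *: (p _)]mulrC.
have congrI q (r s : R) : q = r *: f + s *: g -> p u = r + 2 * k ->
    p v = s + 2 * l -> congr_lattice (dual_lattice L) 2 q p.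
  move=> -> puE pvE; exists (- (k *: f + l *: g)).
    by apply: dN; apply: dD; exact: dZ.
  rewrite [p in LHS]pE puE pvE; apply/lfunP => x.
  rewrite mulr2n !(add_lfunE, opp_lfunE, scale_lfunE) /= /GRing.scale /=; ring.
case: pu pv => [pu|pu] [pv|pv].
- exists 0; split=> //; last by move=> x _; rewrite zero_lfunE normr0.
  by apply: (congrI _ 0 0); rewrite ?scale0r ?addr0 ?add0r.
- exists g; split=> //.
  by apply: (congrI _ 0 1); rewrite ?scale0r ?scale1r ?addr0 ?add0r.
- exists f; split=> //.
  by apply: (congrI _ 1 0); rewrite ?scale0r ?scale1r ?addr0 ?add0r.
exists (f + g); split=> //; first exact: dD.
by apply: (congrI _ 1 1); rewrite ?scale1r.
Qed.

End DualBases.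

(** * The upper bound *)

Section UpperBound.
Context {R : realType} {V : vectType R}.
Implicit Types (L K : set V) (u v x : V) (f g p q : 'Hom(V, R^o)).

Definition class_norm n (W : vectType R) (K L : set W) (p : W) : R :=
  inf [set body_norm K q | q in [set q | L q /\ congr_lattice L n q p]].

Lemma lambda1_le K L x : L x -> x != 0 -> lambda1 K L <= body_norm K x.
Proof.
move=> Lx x0; apply: ge_inf; first by exists 0 => _ [y _ <-]; exact: body_norm_ge0.
by exists x => //; split => //; apply/eqP.
Qed.

Lemma lambda1_ge0 K L : 0 <= lambda1 K L.
Proof.
rewrite /lambda1; set S := [set _ | _ in _].
have [->|/set0P S0] := eqVneq S set0; first by rewrite inf0.
by apply: lb_le_inf => // _ [x _ <-]; exact: body_norm_ge0.
Qed.

Lemma dual_bases_neq0 L u v f g : dual_bases L u v f g -> u != 0.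
Proof.
move=> [_ [fu _ _ _ _]]; apply: contra_eq_neq fu => ->.
by rewrite linear0 eq_sym oner_neq0.
Qed.

(** Shears of u, v are bases, so that the almost minimality of N u + N v
compares each of u and v with u + v and u - v. *)
Lemma almost_reduced_basis L (N : V -> R) e : subgroup L -> is_seminorm N ->
  0 < e -> (exists u v f g, dual_bases L u v f g) ->
  exists u v f g, dual_bases L u v f g /\
    forall w, w = u + v \/ w = u - v -> N u <= N w + e /\ N v <= N w + e.
Proof.
move=> L_subgroup N_ok e0 [u0 [v0 [f0 [g0 b0]]]].
pose S := [set r : R | exists u v f g, dual_bases L u v f g /\ r = N u + N v].
have S_inf : has_inf S.
  split; first by exists (N u0 + N v0), u0, v0, f0, g0.
  by exists 0 => _ [u [v [f [g [_ ->]]]]]; rewrite addr_ge0// seminorm_ge0.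
have [_ [u [v [f [g [b ->]]]]] lt_inf] := inf_adherent e0 S_inf.
have minimal u' v' f' g' : dual_bases L u' v' f' g' ->
    N u + N v <= N u' + N v' + e.
  move=> b'; apply: ltW; apply: lt_le_trans lt_inf _; rewrite lerD2r.
  by apply: ge_inf; [exact: S_inf.2 | exists u', v', f', g'].
have shear u' v' f' g' : dual_bases L u' v' f' g' -> N u + N v = N u' + N v' ->
    N v' <= N (u' + v') + e.
  move=> b' E; have := minimal _ _ _ _ (dual_bases_shear L_subgroup b'); lra.
exists u, v, f, g; split=> // _ [->|->]; split.
- by rewrite [u + v]addrC; apply: shear (dual_bases_swap b) _; rewrite addrC.
- exact: shear b _.
- have := shear _ _ _ _ (dual_bases_opp L_subgroup (dual_bases_swap b)).
  by rewrite -(seminormN (v - u))// opprB !seminormN//; apply; rewrite addrC.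
- have := shear _ _ _ _ (dual_bases_opp L_subgroup b).
  by rewrite seminormN//; apply.
Qed.

(** A positive lambda1 forces every nonzero lattice vector, hence by convexity
every vector, to be absorbed by K, since the norm of a vector that is not
absorbed is 0. *)
Lemma class_norm_bound L K l p : \dim {:V} = 2%N -> is_full_lattice L ->
  convex_set K -> (forall x, K x -> K (- x)) ->
  0 < l -> l < lambda1 K L -> dual_lattice L p ->
  exists q, [/\ dual_lattice L q, congr_lattice (dual_lattice L) 2 q p &
    forall k, K k -> `|q k : R| <= 2 / l].
Proof.
move=> dimV L_lat cK NK l0 l1 Lp.
have L_subgroup := lattice_subgroup L_lat.
have lambda_gt0 := lt_trans l0 l1.
have bases := lattice_dual_bases dimV L_lat.
have lattice_absorbed x : L x -> x != 0 -> absorbs K x.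
  move=> Lx x0; apply: body_norm_gt0_absorbs.
  exact: lt_le_trans (lambda1_le K Lx x0).
have K_absorbs x : absorbs K x.
  have [u [v [f [g b]]]] := bases.
  have u_neq0 := dual_bases_neq0 b.
  have v_neq0 := dual_bases_neq0 (dual_bases_swap b).
  have [[Lu Lv _ _] [_ _ _ _ xE]] := b; rewrite (xE x).
  by apply: absorbsD => //; apply: absorbsZ => //; exact: lattice_absorbed.
set N := body_norm K.
have N_ok : is_seminorm N by exact: body_norm_seminorm.
have e0 : 0 < lambda1 K L - l by rewrite subr_gt0.
have [u [v [f [g [b reduced]]]]] :=
  almost_reduced_basis L_subgroup N_ok e0 bases.
have hu : lambda1 K L <= N u.
  by case: (b) => [[? _ _ _] _]; rewrite lambda1_le ?(dual_bases_neq0 b).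
have hv : lambda1 K L <= N v.
  case: (b) => [[_ ? _ _] _]; rewrite lambda1_le//.
  exact: dual_bases_neq0 (dual_bases_swap b).
have norm_K k : K k -> N k <= 1.
  by move=> Kk; rewrite -[k]scale1r body_norm_le.
have gap w : w = u + v \/ w = u - v -> `|N u - N v| + l <= N w.
  move=> /reduced[wu wv]; rewrite -lerBrDr ler_norml; apply/andP; split; lra.
have expand k : (f k : R) *: u + (g k : R) *: v = k.
  by case: b => _ [_ _ _ _ <-].
have bound_f k : K k -> `|f k : R| <= 2 / l.
  move=> /norm_K Nk; rewrite ler_pdivlMr//.
  have := seminorm_coord_bound (f k) (g k) N_ok (ltW l0)
    (gap _ (or_introl erefl)) (gap _ (or_intror erefl)).
  rewrite expand; lra.
have bound_g k : K k -> `|g k : R| <= 2 / l.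
  move=> /norm_K Nk; rewrite ler_pdivlMr//.
  have := @seminorm_coord_bound _ _ N v u l (g k) (f k) N_ok (ltW l0).
  rewrite [g k *: v + _]addrC [v + u]addrC expand distrC.
  rewrite -(seminormN (v - u))// opprB.
  move=> /(_ (gap _ (or_introl erefl)) (gap _ (or_intror erefl))); lra.
(* Where s and t have opposite signs, |s + t| is at most the larger of |s| and
   |t|, so that only the quadrants where they agree need a new estimate. *)
have sum_bound (s t : 'Hom(V, R^o)) :
    (forall k, K k -> `|s k : R| <= 2 / l) ->
    (forall k, K k -> `|t k : R| <= 2 / l) ->
    (forall k, K k -> 0 <= s k :> R -> 0 <= t k :> R ->
      (s k + t k : R) * l <= 2 * N k) ->
    forall k, K k -> `|(s + t) k : R| <= 2 / l.
  move=> hs ht hst k Kk; rewrite add_lfunE.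
  have /ler_normlP[s1 s2] := hs _ Kk; have /ler_normlP[t1 t2] := ht _ Kk.
  have quadrant k' : K k' -> 0 <= s k' :> R -> 0 <= t k' :> R ->
      (s k' + t k' : R) <= 2 / l.
    move=> Kk' sk tk; rewrite ler_pdivlMr//; have := hst _ Kk' sk tk.
    have := norm_K _ Kk'; lra.
  apply/ler_normlP.
  have [sk|sk] := leP 0 (s k : R); have [tk|tk] := leP 0 (t k : R).
  - have := quadrant k Kk sk tk; split; lra.
  - split; lra.
  - split; lra.
  have := quadrant (- k) (NK _ Kk); rewrite !linearN/= => q.
  have : - (s k : R) + - (t k : R) <= 2 / l by apply: q; lra.
  split; lra.
have [fg_bound|] := pselect (forall k, K k -> 0 <= f k :> R -> 0 <= g k :> R ->
    (f k + g k : R) * l <= 2 * N k).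
  apply: (class_representative b _ bound_f bound_g _ Lp).
    by rewrite divr_ge0// ltW.
  exact: sum_bound.
move=> /existsNP[k /not_implyP[Kk /not_implyP[fk /not_implyP[gk notle]]]].
(* The bound fails at k, hence it holds for f and - g, and f - g represents the
   class of f + g. *)
have bound_Ng k' : K k' -> `|(- g) k' : R| <= 2 / l.
  by move=> /bound_g; rewrite opp_lfunE normrN.
have bN := dual_bases_opp L_subgroup b.
apply: (class_representative bN _ bound_f bound_Ng _ Lp).
  by rewrite divr_ge0// ltW.
apply: sum_bound => // k' Kk' fk' gk'.
have gk'N : 0 <= - (g k' : R) by rewrite -opp_lfunE.
have := @seminorm_quadrant_alternative _ _ N u v l _ _ _ _ N_ok l0
  (ltW (lt_le_trans l1 hu)) (ltW (lt_le_trans l1 hv)) fk gk fk' gk'N.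
rewrite expand scaleNr opprK expand opp_lfunE => -[/notle//|]; exact.
Qed.

Lemma lambda1_mul_class_norm_le2 L K p : normed_lattice 2 L K ->
  dual_lattice L p ->
  lambda1 K L * class_norm 2 (polar K) (dual_lattice L) p <= 2.
Proof.
move=> [dimV L_lat [_ cK _ NK]] Lp; set I := class_norm _ _ _ _.
rewrite leNgt; apply/negP => big.
have lambda_ge0 := lambda1_ge0 K L.
have I_gt0 : 0 < I by nra.
have : 2 / I < lambda1 K L by rewrite ltr_pdivrMr.
move=> /midf_lt[]; set l := (_ + _) / 2 => l1 l2.
have l0 : 0 < l by apply: lt_trans l1; rewrite divr_gt0.
have [q [Lq qp qK]] := class_norm_bound dimV L_lat cK NK l0 l2 Lp.
have : I <= 2 / l.
  apply: (@le_trans _ _ (body_norm (polar K) (q : dual V))); last first.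
    by apply: body_norm_polar_le => //; rewrite divr_gt0.
  apply: ge_inf; last by exists q.
  by exists 0 => _ [t _ <-]; exact: body_norm_ge0.
by rewrite leNgt ltr_pdivrMr// mulrC -ltr_pdivrMr// l1.
Qed.

Lemma lambda1_mul_mu_le2 L K : normed_lattice 2 L K ->
  lambda1 K L * mu 2 (polar K) (dual_lattice L) <= 2.
Proof.
move=> nl; have := lambda1_ge0 K L; rewrite le_eqVlt => /predU1P[<-|l0].
  by rewrite mul0r.
rewrite mulrC -ler_pdivlMr//; apply: ge_sup.
  have [L0 _ _] := dual_lattice_subgroup L.
  by eexists; exists 0; first exact: L0.
move=> _ [p Lp <-]; rewrite ler_pdivlMr// mulrC.
exact: lambda1_mul_class_norm_le2.
Qed.

End UpperBound.

(** * The cube *)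

Section Cube.
Context {R : realType} {V : vectType R}.
Implicit Types (x : V) (q : 'Hom(V, R^o)).

Local Notation e := (vbasis {:V}).

(** Cube and lattice are taken in the coordinates of [vbasis], those through
which the topology of V is read, so that compactness is immediate. *)
Definition cube : set V := [set x | forall i, `|coord e i x| <= 1].

Definition cubic_lattice : set V :=
  [set x | forall i, coord e i x \is a Num.int].

Lemma coord_vbasisE (i j : 'I_(\dim {:V})) : coord e j e`_i = (i == j)%:R.
Proof. exact/coord_free/basis_free/vbasisP. Qed.

Lemma coord_vbasis_inj x y : (forall i, coord e i x = coord e i y) -> x = y.
Proof.
move=> xy; rewrite (coord_vbasis (memvf x)) (coord_vbasis (memvf y)).
by apply: eq_bigr => i _; rewrite xy.
Qed.

Lemma coord_sum_vbasis (a : 'I_(\dim {:V}) -> R) j :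
  coord e j (\sum_i a i *: e`_i) = a j.
Proof. exact/coord_sum_free/basis_free/vbasisP. Qed.

Lemma cubic_lattice_full : is_full_lattice cubic_lattice.
Proof.
exists (e : seq V); first exact: vbasisP.
have sE : size e = \dim {:V} by rewrite size_tuple.
have reindexE (z : 'I_(\dim {:V}) -> int) :
    \sum_(i < size e) e`_i *~ z (cast_ord sE i) = \sum_i (z i)%:~R *: e`_i.
  rewrite [RHS](reindex (cast_ord sE)) /=; last first.
    by exists (cast_ord (esym sE)) => i _; rewrite ?cast_ordK ?cast_ordKV.
  by apply: eq_bigr => i _; rewrite scaler_int.
apply/seteqP; split=> [x Lx|_ [z ->] j] /=.
  exists (fun i => Num.floor (coord e (cast_ord sE i) x)).
  rewrite (reindexE (fun i => Num.floor (coord e i x))).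
  by apply: coord_vbasis_inj => j; rewrite coord_sum_vbasis floorK.
rewrite linear_sum rpred_sum//= => i _.
have /= := coord_vbasisE (cast_ord sE i) j.
by rewrite raddfMz /= => ->; rewrite rpredMz// natr_int.
Qed.

Lemma coordsE x i : coords x ord0 i = coord e i x.
Proof. by rewrite mxE. Qed.

Lemma image_coords_cube :
  @coords R V @` cube = [set w | forall i, `[-1, 1]%classic (w ord0 i)].
Proof.
apply/seteqP; split=> [_ [x Kx <-] i|w Kw] /=.
  by rewrite in_itv /= coordsE -ler_norml Kx.
exists (\sum_i w ord0 i *: e`_i).
  move=> i /=; rewrite coord_sum_vbasis ler_norml.
  by have := Kw i; rewrite /= in_itv.
by apply/rowP => i; rewrite coordsE coord_sum_vbasis.
Qed.

Lemma cube_convex_body : is_symmetric_convex_body cube.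
Proof.
rewrite /is_symmetric_convex_body image_coords_cube; split.
- apply: (@rV_compact R _ (fun=> `[-1, 1]%classic)) => _.
  exact: segment_compact.
- move=> x y t; rewrite !inE => Kx Ky i.
  rewrite /conv /= linearD !linearZ /=.
  have t0 : 0 <= t%:num by [].
  have t1 : 0 <= 1 - t%:num by [].
  apply: le_trans (ler_normD _ _) _; rewrite /unstable.onem !normrM.
  rewrite (ger0_norm t0) (ger0_norm t1); have := Kx i; have := Ky i; nra.
- exists 0; exists (fun _ _ => ball (0 : R) 1).
    by move=> i j; rewrite mxE; exact: nbhsx_ballx.
  move=> w Bw i /=; have := Bw ord0 i.
  by rewrite /ball /= sub0r normrN in_itv /= -ler_norml; exact: ltW.
- by move=> x Kx i; rewrite linearN/= normrN; exact: Kx.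
Qed.

Lemma cube_absorbs x : absorbs cube x.
Proof.
set s := 1 + \sum_i `|coord e i x|.
have coord_le i : `|coord e i x| <= s.
  by rewrite /s (bigD1 i)//= addrCA lerDl addr_ge0// sumr_ge0.
have s0 : 0 < s by rewrite ltr_pwDl// sumr_ge0.
exists s, (s^-1 *: x); split; [exact: ltW | | by rewrite scalerKV ?gt_eqF].
by move=> i; rewrite linearZ/= normrM normfV (gtr0_norm s0) ler_pdivrMl// mulr1.
Qed.

Lemma cube_lattice_norm_ge1 x : cubic_lattice x -> x != 0 ->
  1 <= body_norm cube x.
Proof.
move=> Lx x0; apply: (le_body_norm (cube_absorbs x)) => s k s0 Kk xE.
have [i xi0] : exists i, coord e i x != 0.
  apply/existsP; apply: contraNT x0 => /existsPn x0.
  apply/eqP/coord_vbasis_inj => i; rewrite linear0; apply/eqP.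
  by have := x0 i; rewrite negbK.
apply: (@le_trans _ _ `|coord e i x|); first exact: norm_intr_ge1.
by rewrite xE linearZ/= normrM ger0_norm// ler_piMr.
Qed.

Lemma lambda1_cube : (0 < \dim {:V})%N -> 1 <= lambda1 cube cubic_lattice.
Proof.
move=> d0; apply: lb_le_inf.
  move: (Ordinal d0) => i0; exists (body_norm cube e`_i0), e`_i0 => //.
  split=> [i|e0] /=; first by rewrite coord_vbasisE natr_int.
  have := coord_vbasisE i0 i0.
  by rewrite e0 linear0 eqxx => /eqP; rewrite eq_sym oner_eq0.
move=> _ [x [Lx /eqP x0] <-]; exact: cube_lattice_norm_ge1.
Qed.

Lemma lfun_coordE q x : q x = \sum_i coord e i x * q e`_i :> R.
Proof.
rewrite {1}(coord_vbasis (memvf x)) linear_sum.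
by apply: eq_bigr => i _; rewrite linearZ.
Qed.

(** The polar norm is the l1 norm: q attains it at the vertex of the cube whose
coordinates are the signs of the values of q on the basis. *)
Lemma dim_le_polar_cube_norm q : (0 < \dim {:V})%N ->
  (forall i : 'I_(\dim {:V}), 1 <= `|q e`_i : R|) ->
  (\dim {:V})%:R <= body_norm (polar cube) (q : dual V).
Proof.
move=> d0 q1; set d := (\dim {:V})%:R.
have d_le : d <= \sum_(i < \dim {:V}) `|q e`_i : R|.
  rewrite /d -[X in X%:R]card_ord -sumr_const; exact: ler_sum.
apply: le_body_norm.
  set s := \sum_i _ in d_le.
  have s0 : 0 < s by apply: lt_le_trans d_le; rewrite ltr0n.
  exists s, (s^-1 *: q); split; first exact: ltW; last first.
    by rewrite scalerKV// gt_eqF.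
  apply: polar_scale => // k Kk; rewrite lfun_coordE.
  apply: le_trans (ler_norm_sum _ _ _) _; apply: ler_sum => i _.
  by rewrite normrM ler_piMl.
move=> s h s0 Kh qE; apply: (le_trans d_le).
pose k := \sum_(i < \dim {:V}) Num.sg (q e`_i : R) *: e`_i.
have Kk : cube k by move=> i /=; rewrite coord_sum_vbasis normr_sg; case: eqP.
have -> : \sum_(i < \dim {:V}) `|q e`_i : R| = q k.
  by rewrite lfun_coordE; apply: eq_bigr => i _; rewrite coord_sum_vbasis normrEsg.
rewrite qE scale_lfunE.
have /ler_normlP[_ hk] := Kh _ Kk.
by rewrite -[leRHS]mulr1; apply: ler_wpM2l.
Qed.

Definition coord_sum : 'Hom(V, R^o) :=
  \sum_i linfun (coord e i : V -> R^o).

Lemma coord_sumE x : coord_sum x = \sum_i coord e i x :> R.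
Proof. by rewrite sum_lfunE; apply: eq_bigr => i _; rewrite lfunE. Qed.

Lemma odd_int_norm_ge1 (m k : R) : k \is a Num.int -> m - 1 = k *+ 2 ->
  1 <= `|m|.
Proof.
move=> k_int mE; have mE' : m = k *+ 2 + 1 by lra.
apply: norm_intr_ge1; first by rewrite mE' rpredD ?rpredMn ?rpred1.
apply/eqP => m0; move/intrP: k_int mE' => [z ->].
have -> : z%:~R *+ 2 + 1 = (z * 2 + 1)%:~R :> R.
  by rewrite rmorphD rmorphM /= mulr_natr.
by rewrite m0 => /esym/eqP; rewrite intr_eq0; lia.
Qed.

(** Every element of the class of [coord_sum] takes odd values on the basis. The
boundedness hypothesis gives meaning to the supremum. *)
Lemma mu_cube : (0 < \dim {:V})%N ->
  has_ubound [set class_norm 2 (polar cube) (dual_lattice cubic_lattice) p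
    | p in dual_lattice cubic_lattice] ->
  (\dim {:V})%:R <= mu 2 (polar cube) (dual_lattice cubic_lattice).
Proof.
move=> d0 ub; pose I := class_norm 2 (polar cube) (dual_lattice cubic_lattice).
have Lsum : dual_lattice cubic_lattice coord_sum.
  by move=> x Lx; rewrite coord_sumE rpred_sum// => i _.
apply: (@le_trans _ _ (I coord_sum)); last first.
  by apply: ub_le_sup => //; exists coord_sum.
have [dual0 _ _] := dual_lattice_subgroup cubic_lattice.
apply: lb_le_inf.
  exists (body_norm (polar cube) (coord_sum : dual V)), coord_sum => //.
  by split=> //; exists 0; rewrite ?subrr ?mul0rn.
move=> _ [q [Lq [h Lh qE]] <-]; apply: dim_le_polar_cube_norm => // i.
apply: (@odd_int_norm_ge1 _ (h e`_i)).
  by apply: Lh => j /=; rewrite coord_vbasisE natr_int.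
have /lfunP/(_ e`_i) := qE.
rewrite mulr2n !add_lfunE opp_lfunE coord_sumE mulr2n => <-.
rewrite (bigD1 i)//= coord_vbasisE eqxx big1 ?addr0// => j ji.
by rewrite coord_vbasisE eq_sym (negbTE ji).
Qed.

End Cube.

Theorem proposition3p7 (R : realType) : Theta R 2 2 = 2%:E.
Proof.
apply/eqP; rewrite eq_le; apply/andP; split.
  apply: ge_ereal_sup => _ [V [L [K [nl ->]]]].
  by rewrite lee_fin; exact: lambda1_mul_mu_le2.
pose V : vectType R := 'rV[R]_2.
have dimV : \dim {:V} = 2%N by rewrite dimvf dim_matrix.
have nl : normed_lattice 2 (@cubic_lattice R V) (@cube R V).
  by split=> //; [exact: cubic_lattice_full | exact: cube_convex_body].
have d0 : (0 < \dim {:V})%N by rewrite dimV.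
apply: (@le_trans _ _ (lambda1 (@cube R V) (@cubic_lattice R V) *
    mu 2 (polar (@cube R V)) (dual_lattice (@cubic_lattice R V)))%:E); last first.
  by apply: ereal_sup_ubound; exists V, (@cubic_lattice R V), (@cube R V).
rewrite lee_fin.
have l1 := lambda1_cube d0.
have : 2 <= mu 2 (polar (@cube R V)) (dual_lattice (@cubic_lattice R V)).
  rewrite -[2]/(2%:R) -[X in X%:R]dimV; apply: mu_cube => //.
  exists (2 / lambda1 (@cube R V) (@cubic_lattice R V)) => _ [p Lp <-].
  rewrite ler_pdivlMr; last by apply: lt_le_trans l1.
  by rewrite mulrC; exact: lambda1_mul_class_norm_le2.
nra.
Qed.
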